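(* The fragments $\Sigma_{1,2,1}^{\mathfrak{B}}$ and $\Sigma_{1,0,2}^{\mathfrak{B}}$ are undecidable.
   Context: $\mathcal{L}_{BT}$ is the first-order language (with equality) consisting of the constant symbols $e,0,1$, the binary function symbol $\circ$ and the binary relation symbol $\sqsubseteq$. The $\mathcal{L}_{BT}$-structure $\mathfrak{B}$: its universe is the set $\{\boldsymbol{0},\boldsymbol{1}\}^*$ of all finite bit strings, including the empty string $\varepsilon$; $e^{\mathfrak{B}}=\varepsilon$, $0^{\mathfrak{B}}$ is the one-bit string $\boldsymbol{0}$, $1^{\mathfrak{B}}$ is the one-bit string $\boldsymbol{1}$; $\circ^{\mathfrak{B}}$ is concatenation; and $u \sqsubseteq^{\mathfrak{B}} v$ iff $u$ is a substring of $v$, i.e. iff there exist bit strings $x,y$ with $xuy=v$. Bounded quantifiers: $(\exists x\sqsubseteq t)\alpha$ abbreviates $(\exists x)[x\sqsubseteq t\wedge\alpha]$ and $(\forall x\sqsubseteq t)\alpha$ abbreviates $(\forall x)[x\sqsubseteq t\rightarrow\alpha]$, where $x$ does not occur in the term $t$. The $\Sigma$-formulas are defined inductively: $\alpha$ and $\neg\alpha$ are $\Sigma$-formulas if $\alpha$ is of the form $s\sqsubseteq t$ or $s=t$ for terms $s,t$; $\alpha\vee\beta$ and $\alpha\wedge\beta$ are $\Sigma$-formulas if $\alpha,\beta$ are; $(\exists x\sqsubseteq t)\alpha$, $(\forall x\sqsubseteq t)\alpha$ and $(\exists x)\alpha$ are $\Sigma$-formulas if $\alpha$ is. A $\Sigma$-formula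 is a $\Sigma_{n,m,k}$-formula if it contains $n$ unbounded existential quantifiers, $m$ bounded existential quantifiers and $k$ bounded universal quantifiers. A sentence is a formula with no free variables. The fragment $\Sigma_{n,m,k}^{\mathfrak{B}}$ is the set of $\Sigma_{n,m,k}$-sentences true in $\mathfrak{B}$. A fragment is undecidable if there is no algorithm deciding membership in this set. *)

(* Defs.v *)
From HB Require Import structures.
From mathcomp Require Import all_boot.

Set Implicit Arguments.
Unset Strict Implicit.
Unset Printing Implicit Defensive.

(** * The first-order language L_BT *)

Inductive term : Type :=
| Var of nat
| Te
| T0
| T1
| Tcat of term & term.

Inductive form : Type :=
| Feq of term & term
| Fsub of term & term
| Fnot of form
| Fand of form & form
| For of form & form
| Fimp of form & form
| Fex of nat & form
| Fall of nat & form.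

Fixpoint tvars (t : term) : seq nat :=
  match t with
  | Var x => [:: x]
  | Te | T0 | T1 => [::]
  | Tcat s t => tvars s ++ tvars t
  end.

Fixpoint fvars (f : form) : seq nat :=
  match f with
  | Feq s t | Fsub s t => tvars s ++ tvars t
  | Fnot f => fvars f
  | Fand f g | For f g | Fimp f g => fvars f ++ fvars g
  | Fex x f | Fall x f => [seq y <- fvars f | y != x]
  end.

Definition sentence (f : form) : Prop := fvars f = [::].

Definition bex (x : nat) (t : term) (f : form) : form :=
  Fex x (Fand (Fsub (Var x) t) f).
Definition ball (x : nat) (t : term) (f : form) : form :=
  Fall x (Fimp (Fsub (Var x) t) f).

(** [Sigma_form n m k f]: [f] is built as a Sigma-formula using exactly [n]
    unbounded existential, [m] bounded existential and [k] bounded universal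
    quantifiers.  Bounded quantifiers being abbreviations, one formula may have
    several such readings: [bex x t f] can also be read as an unbounded
    quantifier in front of a conjunction. *)
Inductive Sigma_form : nat -> nat -> nat -> form -> Prop :=
| Sigma_eq s t : Sigma_form 0 0 0 (Feq s t)
| Sigma_sub s t : Sigma_form 0 0 0 (Fsub s t)
| Sigma_neq s t : Sigma_form 0 0 0 (Fnot (Feq s t))
| Sigma_nsub s t : Sigma_form 0 0 0 (Fnot (Fsub s t))
| Sigma_or n m k n' m' k' f g :
    Sigma_form n m k f -> Sigma_form n' m' k' g ->
    Sigma_form (n + n') (m + m') (k + k') (For f g)
| Sigma_and n m k n' m' k' f g :
    Sigma_form n m k f -> Sigma_form n' m' k' g ->
    Sigma_form (n + n') (m + m') (k + k') (Fand f g)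
| Sigma_bex n m k x t f :
    x \notin tvars t -> Sigma_form n m k f ->
    Sigma_form n m.+1 k (bex x t f)
| Sigma_ball n m k x t f :
    x \notin tvars t -> Sigma_form n m k f ->
    Sigma_form n m k.+1 (ball x t f)
| Sigma_ex n m k x f :
    Sigma_form n m k f -> Sigma_form n.+1 m k (Fex x f).

Record structure : Type := Structure {
  carrier :> Type;
  i_e : carrier;
  i_0 : carrier;
  i_1 : carrier;
  i_cat : carrier -> carrier -> carrier;
  i_sub : carrier -> carrier -> Prop }.

Fixpoint teval (S : structure) (rho : nat -> S) (t : term) : S :=
  match t with
  | Var x => rho x
  | Te => i_e S
  | T0 => i_0 S
  | T1 => i_1 S
  | Tcat s t => i_cat (teval rho s) (teval rho t)
  end.

Definition update (D : Type) (rho : nat -> D) (x : nat) (d : D) : nat -> D :=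
  fun y => if y == x then d else rho y.

Fixpoint sat (S : structure) (rho : nat -> S) (f : form) : Prop :=
  match f with
  | Feq s t => teval rho s = teval rho t
  | Fsub s t => i_sub (teval rho s) (teval rho t)
  | Fnot f => ~ sat rho f
  | Fand f g => sat rho f /\ sat rho g
  | For f g => sat rho f \/ sat rho g
  | Fimp f g => sat rho f -> sat rho g
  | Fex x f => exists d : S, sat (update rho x d) f
  | Fall x f => forall d : S, sat (update rho x d) f
  end.

Definition true_in (S : structure) (f : form) : Prop :=
  forall rho : nat -> S, sat rho f.

(** The bits are [false] (for 0) and [true] (for 1); by [infixP], [infix u v]
    holds iff [v = x ++ u ++ y] for some [x] and [y]. *)
Definition frakB : structure :=
  @Structure (seq bool) [::] [:: false] [:: true] cat (fun u v => infix u v).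

Definition fragment (n m k : nat) (f : form) : Prop :=
  [/\ Sigma_form n m k f, sentence f & true_in frakB f].

(** * Formulas as words over a finite alphabet *)

Inductive symbol : Type :=
| Svar | Stick | Se | S0 | S1 | Scat | Seq | Ssub
| Snot | Sand | Sor | Simp | Sex | Sall.

Definition symbols : seq symbol :=
  [:: Svar; Stick; Se; S0; S1; Scat; Seq; Ssub;
      Snot; Sand; Sor; Simp; Sex; Sall].

Definition symbol_rank (a : symbol) : nat :=
  match a with
  | Svar => 0 | Stick => 1 | Se => 2 | S0 => 3 | S1 => 4 | Scat => 5
  | Seq => 6 | Ssub => 7 | Snot => 8 | Sand => 9 | Sor => 10 | Simp => 11
  | Sex => 12 | Sall => 13
  end.

Lemma symbol_rankK :
  pcancel symbol_rank (fun i => nth None (map Some symbols) i).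
Proof. by case. Qed.

HB.instance Definition _ := Countable.copy symbol (pcan_type symbol_rankK).

Lemma symbols_enumP : Finite.axiom symbols.
Proof. by case. Qed.

HB.instance Definition _ := isFinite.Build symbol symbols_enumP.

(** Polish notation; the variable of index [x] is written as [x] ticks
    followed by [Svar]. *)
Definition encode_var (x : nat) : seq symbol := rcons (nseq x Stick) Svar.

Fixpoint encode_term (t : term) : seq symbol :=
  match t with
  | Var x => encode_var x
  | Te => [:: Se]
  | T0 => [:: S0]
  | T1 => [:: S1]
  | Tcat s t => Scat :: encode_term s ++ encode_term t
  end.

Fixpoint encode (f : form) : seq symbol :=
  match f with
  | Feq s t => Seq :: encode_term s ++ encode_term t
  | Fsub s t => Ssub :: encode_term s ++ encode_term t
  | Fnot f => Snot :: encode f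
  | Fand f g => Sand :: encode f ++ encode g
  | For f g => Sor :: encode f ++ encode g
  | Fimp f g => Simp :: encode f ++ encode g
  | Fex x f => Sex :: encode_var x ++ encode f
  | Fall x f => Sall :: encode_var x ++ encode f
  end.

Lemma encode_var_prefix x y u v :
  encode_var x ++ u = encode_var y ++ v -> x = y /\ u = v.
Proof.
rewrite /encode_var; elim: x y => [|x IHx] [|y] //=; first by case.
by case=> /IHx [-> ->].
Qed.

Lemma encode_term_prefix s t u v :
  encode_term s ++ u = encode_term t ++ v -> s = t /\ u = v.
Proof.
elim: s t u v => [x|||| s1 IH1 s2 IH2] [y|||| t1 t2] u v //=;
  try by [case: x | case: y | case=> ->].
- by move=> /encode_var_prefix [-> ->].
- by case; rewrite -!catA => /IH1 [-> /IH2 [-> ->]].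
Qed.

Lemma encode_prefix f g u v :
  encode f ++ u = encode g ++ v -> f = g /\ u = v.
Proof.
elim: f g u v => [s t|s t|f IHf|f1 IH1 f2 IH2|f1 IH1 f2 IH2|f1 IH1 f2 IH2
  |x f IHf|x f IHf] [s' t'|s' t'|g|g1 g2|g1 g2|g1 g2|y g|y g] u v //=;
  case; rewrite -?catA.
- by move=> /encode_term_prefix [-> /encode_term_prefix [-> ->]].
- by move=> /encode_term_prefix [-> /encode_term_prefix [-> ->]].
- by move=> /IHf [-> ->].
- by move=> /IH1 [-> /IH2 [-> ->]].
- by move=> /IH1 [-> /IH2 [-> ->]].
- by move=> /IH1 [-> /IH2 [-> ->]].
- by move=> /encode_var_prefix [-> /IHf [-> ->]].
- by move=> /encode_var_prefix [-> /IHf [-> ->]].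
Qed.

Lemma encode_inj : injective encode.
Proof.
by move=> f g fg; case: (@encode_prefix f g [::] [::]); rewrite ?cats0.
Qed.

(** * Decidability by Turing machines *)

Inductive move : Type := Left | Stay | Right.

(** Deterministic machines with one two-way infinite tape.  The tape alphabet
    consists of the blank [None], the input alphabet [A] and a finite set of
    auxiliary symbols. *)
Record machine (A : finType) : Type := Machine {
  state : finType;
  aux : finType;
  q_start : state;
  q_accept : state;
  q_reject : state;
  accept_neq_reject : q_accept != q_reject;
  delta : state -> option (A + aux) -> state * option (A + aux) * move }.

Section Runs.
Variables (A : finType) (M : machine A).

Definition tape_symbol : Type := option (A + aux M).

(** [Config q l a r]: the head scans [a]; [l] lists the cells to its left and
    [r] those to its right, nearest first; all further cells are blank. *)
Record config : Type := Config {
  c_state : state M;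
  c_left : seq tape_symbol;
  c_head : tape_symbol;
  c_right : seq tape_symbol }.

Definition init (w : seq A) : config :=
  let tape := [seq Some (inl a) | a <- w] in
  Config (q_start M) [::] (head None tape) (behead tape).

(** Accepting and rejecting configurations are left unchanged. *)
Definition step (c : config) : config :=
  let: Config q l a r := c in
  if (q == q_accept M) || (q == q_reject M) then c else
  let: (q', b, d) := delta q a in
  match d with
  | Left => Config q' (behead l) (head None l) (b :: r)
  | Stay => Config q' l b r
  | Right => Config q' (b :: l) (head None r) (behead r)
  end.

Definition accepts (w : seq A) : Prop :=
  exists i : nat, c_state (iter i step (init w)) = q_accept M.
Definition rejects (w : seq A) : Prop :=
  exists i : nat, c_state (iter i step (init w)) = q_reject M.

Definition decides (L : seq A -> Prop) : Prop :=
  forall w : seq A, (L w -> accepts w) /\ (~ L w -> rejects w).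

End Runs.

Definition decidable_language (A : finType) (L : seq A -> Prop) : Prop :=
  exists M : machine A, decides M L.

Definition undecidable (P : form -> Prop) : Prop :=
  ~ decidable_language (fun w => exists2 f : form, P f & w = encode f).

(* Main.v *)
Require Import Defs.
From mathcomp Require Import all_boot.

(** Consider rewriting rules on whole words that replace [p ++ y ++ q] by a word
    in which [y] may occur several times.  With words as blocks [# x #] of a bit
    string [u], "[u] contains the start word and is closed under the rules" needs
    one unbounded existential and one bounded universal quantifier (for [y]).  If
    the rules are deterministic and halt on the start word, a suitable [u]
    omitting a given letter exists iff that letter is never produced.

    Given a machine [M] deciding the fragment, a finite rule set maps a word [w]
    to [diagonal w], the text of a sentence whose first part is [w] and whose
    second part names [w], and then runs [M] on it.  For a suitable [w] that
    sentence says that this process does not reach the accepting state of [M], so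
    [M] answers wrongly on it.  The remaining quantifiers are padding. *)

Set Implicit Arguments.
Unset Strict Implicit.
Unset Printing Implicit Defensive.

(** * Self-delimiting binary code of words over a countable alphabet *)

Section Coding.
Variable T : countType.
Implicit Types (a : T) (s : seq T) (u v : seq bool).

Definition letter_code a : seq bool :=
  false :: rcons (nseq (pickle a).+1 true) false.

Definition word_code s : seq bool := flatten (map letter_code s).

Lemma word_code_cat s1 s2 : word_code (s1 ++ s2) = word_code s1 ++ word_code s2.
Proof. by rewrite /word_code map_cat flatten_cat. Qed.

Lemma word_code1 a : word_code [:: a] = letter_code a.
Proof. exact: cats0. Qed.

Lemma ones_eq m n u v :
  nseq m true ++ false :: u = nseq n true ++ false :: v -> m = n /\ u = v.
Proof.
elim: m n => [|m IHm] [|n] //=; first by case.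
by case=> /IHm [-> ->].
Qed.

(** Each letter is [0 1^i 0] with [i > 0], so maximal runs of ones mark the letters
    and an occurrence of a letter code is always aligned. *)
Lemma word_code_letter s u a v :
    word_code s = u ++ letter_code a ++ v ->
  exists s1 s2, [/\ s = s1 ++ a :: s2, u = word_code s1 & v = word_code s2].
Proof.
elim: s u => [|b s IHs] u; first by case: u.
rewrite /word_code /= -/(word_code s) cat_rcons.
case: u => [|x u] /=.
  rewrite cat_rcons -!cat_cons -!/(nseq _.+1 true) => -[/ones_eq []].
  case=> /(pcan_inj pickleK) -> <-.
  by exists [::], s.
case=> <-; rewrite -cat_cons -!/(nseq _.+1 true).
(* The occurrence cannot start in the rest of the current letter: it begins with [01], whereas the
   final [0] of a letter is followed by another [0] or by nothing. *)
have skip n w : nseq n true ++ false :: word_code s = w ++ letter_code a ++ v ->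
    exists2 w', w = nseq n true ++ false :: w'
              & word_code s = w' ++ letter_code a ++ v.
  elim: n w => [|n IHn] [|y w] //=.
  - by case: (s).
  - by case=> <- ->; exists w.
  - by case=> <- /IHn [w' -> ->]; exists w'.
case/(skip _.+1 u)=> w -> /IHs [s1 [s2 [-> -> ->]]].
by exists (b :: s1), s2; rewrite /word_code /= cat_rcons.
Qed.

(** Alignment of the first letter propagates to the others. An empty [p] has to be excluded, as it
    occurs at unaligned places too. *)
Lemma word_code_infix s u p v :
    p != [::] -> word_code s = u ++ word_code p ++ v ->
  exists s1 s2, [/\ s = s1 ++ p ++ s2, u = word_code s1 & v = word_code s2].
Proof.
elim: p s u => // a p IHp s u _.
rewrite /word_code /= -/(word_code _) -/(word_code p) -catA.
case/word_code_letter=> s1 [s2 [-> -> eq_v]].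
have [p0 | p_neq0] := eqVneq p [::].
  by exists s1, s2; rewrite p0 /= in eq_v *.
(* The rest of [p] follows at once: the part skipped before it has empty code, hence is empty. *)
have /(IHp s2 [::] p_neq0) [[|b s3] [s4 [-> // _ ->]]] := esym eq_v.
by exists s1, s4.
Qed.

Lemma letter_code_infix a s :
  infix (letter_code a) (word_code s) -> a \in s.
Proof.
case/infixP=> u [v /word_code_letter [s1 [s2 [-> _ _]]]].
by rewrite mem_cat mem_head orbT.
Qed.

Lemma infix_letter_code a s :
  a \in s -> infix (letter_code a) (word_code s).
Proof.
case/splitPr=> s1 s2; apply/infixP; exists (word_code s1), (word_code s2).
by rewrite word_code_cat.
Qed.

Lemma infix_word_code s1 s2 :
  infix s1 s2 -> infix (word_code s1) (word_code s2).
Proof.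
case/infixP=> s [s' ->]; apply/infixP; exists (word_code s), (word_code s').
by rewrite !word_code_cat.
Qed.

End Coding.

Arguments letter_code : simpl never.

(** * Rewriting of whole words, and closed histories as bit strings *)

Section Rewriting.
Variable L : countType.
Implicit Types (x y : seq L) (S : seq (seq L)).

(** The rule [(p, q, o)] rewrites [p ++ y ++ q] to [o], with [y] substituted
    for every [None] in [o]. *)
Definition rule : Type := (seq L * seq L * seq (option L))%type.

Definition fill y (o : seq (option L)) : seq L :=
  flatten [seq if c is Some a then [:: a] else y | c <- o].

Variable rules : seq rule.

Inductive rewrites x x' : Prop :=
  Rewrites r y of r \in rules & x = r.1.1 ++ y ++ r.1.2 & x' = fill y r.2.

Inductive reach x : seq L -> Prop :=
| reach_refl : reach x x
| reach_step x' x'' : reach x x' -> rewrites x' x'' -> reach x x''.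

Lemma reach_trans x x' x'' : reach x x' -> reach x' x'' -> reach x x''.
Proof. by move=> xx'; elim=> // y z _ xy /(reach_step xy). Qed.

Variable bad : L.

(** As an inductive predicate it describes a finite run, whose words can be listed; uniqueness of
    successors makes that list closed. *)
Inductive safe : seq L -> Prop :=
| safe_halt x : bad \notin x -> (forall x', ~ rewrites x x') -> safe x
| safe_step x x' : bad \notin x -> (forall y, rewrites x y -> y = x') ->
    safe x' -> safe x.

Definition closed S : Prop :=
  forall x x', x \in S -> rewrites x x' -> x' \in S.

Lemma safe_closed x :
  safe x -> exists S, [/\ x \in S, closed S & {in S, forall y, bad \notin y}].
Proof.
elim=> {x} [x xP x_halt|x x' xP x_det _ [S [x'S S_closed SP]]].
  exists [:: x]; split=> [|y z|y]; rewrite ?inE // => /eqP -> //.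
  by case/x_halt.
exists (x :: S); split=> [|y z|y]; rewrite ?inE ?eqxx //.
  case/predU1P=> [-> /x_det ->|/S_closed yP /yP ->]; rewrite ?x'S orbT //.
by case/predU1P=> [->|/SP].
Qed.

(** The letter [None] of [option L] separates the words of a history. *)
Definition block x : seq (option L) := None :: rcons (map Some x) None.

(** Neighbouring words share one separator, so consecutive blocks overlap in a letter. *)
Definition history S : seq (option L) :=
  None :: flatten [seq rcons (map Some x) None | x <- S].

Lemma map_Some_sep x y s t :
  map Some x ++ None :: s = map Some y ++ None :: t -> x = y /\ s = t.
Proof.
elim: x y => [|a x IHx] [|b y] //=; first by case.
by case=> -> /IHx [-> ->].
Qed.

Lemma map_Some_cat x s s' t :
    map Some x ++ s = s' ++ None :: t ->
  exists2 s'', s' = map Some x ++ s'' & s = s'' ++ None :: t.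
Proof.
elim: x s' => [|a x IHx] [|c s'] //=; try by eexists.
by case=> <- /IHx [s'' -> ->]; exists s''.
Qed.

(** The words themselves are free of separators, so a block can only sit between two consecutive
    ones. *)
Lemma infix_history x S : infix (block x) (history S) = (x \in S).
Proof.
apply/idP/idP.
  case/infixP=> s [t]; elim: S s => [|y S IHS] s.
    by rewrite /block /history /=; case: s => [|c [|]] //; case: (x).
  rewrite /history /= cat_rcons; case: s => [|c s].
    rewrite /block /= cat_rcons inE; case=> /map_Some_sep [-> _].
    by rewrite eqxx.
  case=> _; rewrite /block -/(history S).
  case/map_Some_cat=> s' _ /IHS; rewrite inE => ->.
  by rewrite orbT.
elim: S => // y S IHS; rewrite inE => /predU1P [->|/IHS /infixP [s [t eqS]]].
  by apply/infixP; exists [::]; eexists.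
have -> : history (y :: S) = (None :: map Some y) ++ history S.
  by rewrite /history /= cat_rcons.
by rewrite eqS; apply/infixP; exists ((None :: map Some y) ++ s), t; rewrite -catA.
Qed.

Lemma mem_history a S :
  (Some a \in history S) = has (fun x => a \in x) S.
Proof.
rewrite inE /=; elim: S => //= x S IHS.
by rewrite mem_cat IHS mem_rcons inE /= mem_map // => b c [].
Qed.

Definition encodes (u : seq bool) x : bool := infix (word_code (block x)) u.

Definition fill_code (v : seq bool) (o : seq (option L)) : seq bool :=
  flatten [seq if c is Some a then letter_code (Some a) else v | c <- o].

Lemma fill_code_word y o :
  fill_code (word_code (map Some y)) o = word_code (map Some (fill y o)).
Proof.
elim: o => //= c o IHo; rewrite /fill_code /fill /= map_cat word_code_cat.
by congr (_ ++ _) => //; case: c => // a; rewrite word_code1.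
Qed.

(** A bounded quantifier lets [v] range over all substrings of [u], codes or not; the first
    alternative discards those containing a separator. *)
Definition closed_code (u : seq bool) : Prop :=
  forall v, infix v u ->
    infix (letter_code (None : option L)) v \/
    forall r, r \in rules ->
      ~ infix (word_code (None :: map Some r.1.1) ++ v
               ++ word_code (rcons (map Some r.1.2) None)) u \/
      infix (letter_code (None : option L) ++ fill_code v r.2
             ++ letter_code (None : option L)) u.

Lemma word_code_block x :
  word_code (block x) = letter_code (None : option L) ++ word_code (map Some x)
                        ++ letter_code (None : option L).
Proof. by rewrite /block -cats1 -cat1s !word_code_cat !word_code1. Qed.

(** Here [u] need not be a history: the code of [y] is a substring of [u] without separator code, so
    the closure condition applies to it. *)
Lemma closed_code_reach u x x' :
  closed_code u -> encodes u x -> reach x x' -> encodes u x'.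
Proof.
move=> u_closed ux; elim=> // {}x' x'' _ ux' [r y r_rule eq_x' ->] {x''}.
have eqb : word_code (block x') = word_code (None :: map Some r.1.1)
    ++ word_code (map Some y) ++ word_code (rcons (map Some r.1.2) None).
  by rewrite -!word_code_cat eq_x' /block !map_cat !rcons_cat.
rewrite /encodes eqb in ux'.
have uy : infix (word_code (map Some y)) u.
  by apply: infix_trans ux'; apply: infix_infix.
case: (u_closed _ uy) => [/letter_code_infix /mapP [] //|/(_ _ r_rule)] /=.
by rewrite /encodes word_code_block fill_code_word; case.
Qed.

Lemma closed_history S : closed S -> closed_code (word_code (history S)).
Proof.
move=> S_closed v _; have [|v_sep] := boolP (infix (letter_code None) v).
  by left.
right=> -[[p q] o] r_rule.
set b := infix (_ ++ _) _; have [/infixP [s [t]]|/negP] := boolP b; last by left.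
(* Aligning first the left context and then the right one forces the arbitrary bit string [v]
   between them to be the code of a word [s3]. *)
rewrite -[_ ++ t]catA -(catA v) => /word_code_infix [] // s1 [s2 [eq_h _ eq_s2]]; right.
have /word_code_infix [] // := esym eq_s2; first by case: (q).
move=> s3 [s4 [eq_s2' eq_v _]].
have s3_sep : None \notin s3.
  by apply: contra v_sep; rewrite eq_v; apply: infix_letter_code.
have eq_s3 : s3 = map Some (pmap id s3).
  by elim: s3 s3_sep {eq_s2' eq_v} => //= -[c|] s3 IHs //=; rewrite inE => /IHs <-.
have xS : p ++ pmap id s3 ++ q \in S.
  rewrite -infix_history eq_h eq_s2' /block !map_cat -eq_s3 !rcons_cat.
  by apply/infixP; exists s1, s4; rewrite /= -!catA.
have {}xS := S_closed _ _ xS (Rewrites r_rule erefl erefl).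
rewrite eq_v eq_s3 fill_code_word -word_code_block.
by apply: infix_word_code; rewrite infix_history.
Qed.

End Rewriting.

(** * The sentence expressing safety of a start word *)

Section Formula.

Definition bits_term (s : seq bool) (t : term) : term :=
  foldr (fun b => Tcat (if b then T1 else T0)) t s.

Lemma teval_bits_term (rho : nat -> frakB) s t :
  teval rho (bits_term s t) = s ++ teval rho t.
Proof. by elim: s => //= -[] s ->. Qed.

Lemma tvars_bits_term s t : tvars (bits_term s t) = tvars t.
Proof. by elim: s => //= -[]. Qed.

Arguments bits_term : simpl never.

(** Since [bits_term] nests to the right, Polish notation turns a literal into a bitwise
    concatenation. This is a morphism, so rewriting rules can produce it letter by letter. *)
Definition encode_bits (s : seq bool) : seq symbol :=
  flatten [seq [:: Scat; if b then S1 else S0] | b <- s].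

Lemma encode_bits_term s t :
  encode_term (bits_term s t) = encode_bits s ++ encode_term t.
Proof. by elim: s => // -[] s IHs; rewrite /= -/(bits_term s t) IHs. Qed.

Lemma encode_bits_cat s1 s2 :
  encode_bits (s1 ++ s2) = encode_bits s1 ++ encode_bits s2.
Proof. by rewrite /encode_bits map_cat flatten_cat. Qed.

Definition padding (n m k : nat) : form :=
  iter n (Fex 1) (iter m (bex 1 Te) (iter k (ball 1 Te) (Feq Te Te))).

Lemma Sigma_padding n m k : Sigma_form n m k (padding n m k).
Proof.
elim: n => [|n IHn]; last exact: Sigma_ex.
elim: m => [|m IHm]; last exact: Sigma_bex.
by elim: k => [|k IHk]; [apply: Sigma_eq | apply: Sigma_ball].
Qed.

Lemma fvars_padding n m k : fvars (padding n m k) = [::].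
Proof.
rewrite /padding; elim: n => [|n /= -> //].
elim: m => [|m /= -> //]; by elim: k => //= k ->.
Qed.

Lemma sat_padding n m k (rho : nat -> frakB) : sat rho (padding n m k).
Proof.
rewrite /padding; elim: n rho => [|n IHn] rho /=; last by exists [::].
elim: m rho => [|m IHm] rho /=; last by exists [::].
by elim: k rho => //= k IHk rho v _; apply: IHk.
Qed.

Variables (L : countType) (rules : seq (rule L)) (bad : L) (n m k : nat).

Definition code_term (s : seq (option L)) (t : term) : term :=
  bits_term (word_code s) t.

Definition sep_term (t : term) : term := bits_term (letter_code (None : option L)) t.

(** Variable 0 stands for the bit string [u], variable 1 for its substring [v]. *)
Definition lhs_term (p q : seq L) : term :=
  code_term (None :: map Some p)
    (Tcat (Var 1) (code_term (rcons (map Some q) None) Te)).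

Definition rhs_term (o : seq (option L)) : term :=
  sep_term (foldr (fun c t => if c is Some a
                              then bits_term (letter_code (Some a)) t
                              else Tcat (Var 1) t) (sep_term Te) o).

Definition rule_form (r : rule L) : form :=
  For (Fnot (Fsub (lhs_term r.1.1 r.1.2) (Var 0))) (Fsub (rhs_term r.2) (Var 0)).

(** The conjunction over the rules is under the quantifier, so that one bounded universal quantifier
    serves them all. *)
Definition closed_form : form :=
  ball 1 (Var 0) (For (Fsub (sep_term Te) (Var 1))
    (foldr (fun r => Fand (rule_form r)) (Feq Te Te) rules)).

Definition side_form : form :=
  Fand (Fand (padding n m k) closed_form)
       (Fnot (Fsub (bits_term (letter_code (Some bad)) Te) (Var 0))).

(** The start word is mentioned last, and only once: the text up to its literal does not depend on
    [x], which the self-reference exploits. *)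
Definition safe_form (x : seq L) : form :=
  Fex 0 (Fand side_form (Fsub (code_term (block x) Te) (Var 0))).

Lemma Sigma_safe_form x : Sigma_form n.+1 m k.+1 (safe_form x).
Proof.
suff: Sigma_form (n + 0 + 0 + 0).+1 (m + 0 + 0 + 0) (k + 1 + 0 + 0) (safe_form x).
  by rewrite !addn0 addn1.
apply: Sigma_ex; apply: (Sigma_and _ (Sigma_sub _ _)).
apply: (Sigma_and _ (Sigma_nsub _ _)); apply: (Sigma_and (Sigma_padding _ _ _)).
apply: Sigma_ball => //; apply: (Sigma_or (Sigma_sub _ _)).
elim: rules => [|r rs IHrs] /=; first exact: Sigma_eq.
exact: (Sigma_and (Sigma_or (Sigma_nsub _ _) (Sigma_sub _ _)) IHrs).
Qed.

Lemma sentence_safe_form x : sentence (safe_form x).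
Proof.
have fvars_rules : all (fun z => (z == 0) || (z == 1))
    (fvars (foldr (fun r => Fand (rule_form r)) (Feq Te Te) rules)).
  elim: rules => //= r rs IHrs; rewrite !all_cat IHrs andbT.
  rewrite /rhs_term /sep_term /code_term !tvars_bits_term /= andbT.
  rewrite tvars_bits_term /= andbT.
  by elim: r.2 => [|[a|] o IHo] //=; rewrite tvars_bits_term.
rewrite /sentence /= fvars_padding /code_term /sep_term !tvars_bits_term /=.
elim: (fvars _) fvars_rules => //= z s IHs /andP [z01 /IHs].
by case/orP: z01 => /eqP ->.
Qed.

Lemma teval_lhs_term (rho : nat -> frakB) p q :
  teval rho (lhs_term p q) = word_code (None :: map Some p) ++ rho 1
                             ++ word_code (rcons (map Some q) None).
Proof.
have tevalE s t : teval rho (Tcat s t) = teval rho s ++ teval rho t by [].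
by rewrite /lhs_term /code_term teval_bits_term tevalE teval_bits_term cats0.
Qed.

Lemma teval_rhs_term (rho : nat -> frakB) o :
  teval rho (rhs_term o) = letter_code (None : option L) ++ fill_code (rho 1) o
                           ++ letter_code (None : option L).
Proof.
rewrite /rhs_term /sep_term teval_bits_term; congr (_ ++ _).
elim: o => [|[a|] o IHo] /=; rewrite ?teval_bits_term ?cats0 //.
- by rewrite IHo catA.
- by rewrite IHo catA.
Qed.

Lemma sat_closed_form (rho : nat -> frakB) :
  sat rho closed_form <-> closed_code rules (rho 0).
Proof.
have sat_rules (rho' : nat -> frakB) (rs : seq (rule L)) :
    sat rho' (foldr (fun r => Fand (rule_form r)) (Feq Te Te) rs) <->
    forall r, r \in rs ->
      ~ infix (word_code (None :: map Some r.1.1) ++ rho' 1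
               ++ word_code (rcons (map Some r.1.2) None)) (rho' 0) \/
      infix (letter_code (None : option L) ++ fill_code (rho' 1) r.2
             ++ letter_code (None : option L)) (rho' 0).
  elim: rs => // r rs IHrs; rewrite [foldr _ _ _]/=.
  split=> [[rP /IHrs rsP] r'|rsP].
    rewrite inE -teval_lhs_term -teval_rhs_term => /predU1P [-> //|/rsP].
    by rewrite -teval_lhs_term -teval_rhs_term.
  split; last by apply/IHrs=> r' r'rs; apply: rsP; rewrite inE r'rs orbT.
  by have := rsP r (mem_head _ _); rewrite -teval_lhs_term -teval_rhs_term.
have sepE (rho' : nat -> frakB) :
    teval rho' (sep_term Te) = letter_code (None : option L).
  by rewrite /sep_term teval_bits_term cats0.
split=> rhoP v v_in; case: (rhoP v v_in).
- by left; rewrite -(sepE (update rho 1 v)).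
- by move/sat_rules; right.
- by rewrite -(sepE (update rho 1 v)); left.
- by right; apply/sat_rules.
Qed.

Lemma true_safe_form x :
  true_in frakB (safe_form x) <->
  exists u,
    [/\ closed_code rules u, ~ infix (letter_code (Some bad)) u & encodes u x].
Proof.
have satP (rho : nat -> frakB) : sat rho (safe_form x) <-> exists u,
    [/\ closed_code rules u, ~ infix (letter_code (Some bad)) u & encodes u x].
  have badE (rho' : nat -> frakB) :
      teval rho' (bits_term (letter_code (Some bad)) Te) = letter_code (Some bad).
    by rewrite teval_bits_term cats0.
  have xE (rho' : nat -> frakB) :
      teval rho' (code_term (block x) Te) = word_code (block x).
    by rewrite /code_term teval_bits_term cats0.
  split=> -[u].
    case=> -[[_ /sat_closed_form u_closed] u_bad] ux; exists u; split=> //.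
      by rewrite -(badE (update rho 0 u)).
    by rewrite /encodes -(xE (update rho 0 u)).
  case=> u_closed u_bad ux; exists u; split; last first.
    by rewrite /encodes -(xE (update rho 0 u)) in ux.
  split; last by rewrite -(badE (update rho 0 u)) in u_bad.
  by split; [apply: sat_padding | apply/sat_closed_form].
split=> [xP|xP rho]; last exact/satP.
exact/(satP (fun=> [::])).
Qed.

(** Any candidate [u] contains the codes of all reachable words, hence that of the bad letter. *)
Lemma reach_bad_unsafe x x' :
  reach rules x x' -> bad \in x' -> ~ true_in frakB (safe_form x).
Proof.
move=> xx' x'_bad /true_safe_form [u [u_closed u_bad ux]]; case: u_bad.
apply: infix_trans (closed_code_reach u_closed ux xx').
apply: infix_letter_code.
by rewrite inE mem_rcons inE mem_map ?x'_bad ?orbT // => ? ? [].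
Qed.

(** The witness is the coded history of the finite run. *)
Lemma safe_true x : safe rules bad x -> true_in frakB (safe_form x).
Proof.
case/safe_closed=> S [xS S_closed SP]; apply/true_safe_form.
exists (word_code (history S)); split; first exact: closed_history.
  by move/letter_code_infix; rewrite mem_history => /hasP [y /SP /negP].
by apply: infix_word_code; rewrite infix_history.
Qed.

End Formula.

(** * Deterministic rewriting sequences that avoid the bad letter *)

Section Leads.
Variables (L : countType) (rules : seq (rule L)) (bad : L).

(** Reachability carries a bad letter forward from an accepting run; the second half carries safety
    back from a rejecting one. *)
Definition leads (x x' : seq L) : Prop :=
  reach rules x x' /\ (safe rules bad x' -> safe rules bad x).

Lemma leads_refl x : leads x x.
Proof. by split=> //; apply: reach_refl. Qed.

Lemma leads_trans x x' x'' : leads x x' -> leads x' x'' -> leads x x''.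
Proof.
by case=> xx' sx [xx'' sx']; split=> [|/sx' /sx //]; apply: reach_trans xx''.
Qed.

Lemma leads_step x x' :
  bad \notin x -> (forall y, rewrites rules x y <-> y = x') -> leads x x'.
Proof.
move=> xP x_det; split; last by apply: safe_step => // y /x_det.
by apply: reach_step (reach_refl _ _) _; apply/x_det.
Qed.

Lemma fill_cons y c o :
  fill y (c :: o) = (if c is Some a then [:: a] else y) ++ @fill L y o.
Proof. by []. Qed.

Lemma fill_Some y s : fill y (map Some s) = s :> seq L.
Proof. by elim: s => //= a s IHs; rewrite fill_cons IHs. Qed.

End Leads.

(** * Building the diagonal text and running the machine on it by rewriting *)

Section Simulation.
Variable M : machine symbol.

(** States, tape symbols including the blank, and three extra letters: an end marker and the heads
    of the copying and expanding phases. *)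
Definition letter : finType :=
  (state M + option (symbol + aux M) + option bool)%type.

Definition Lstate (q : state M) : letter := inl (inl q).
Definition Ltape (a : tape_symbol M) : letter := inl (inr a).
Definition Lend : letter := inr None.
Definition Lcopy : letter := inr (Some false).
Definition Lexpand : letter := inr (Some true).
Definition Linput (a : symbol) : letter := Ltape (Some (inl a)).

(** The text that a symbol of [w] contributes to the literal naming [w]. *)
Definition expansion (a : symbol) : seq symbol :=
  encode_bits (letter_code (Some (Linput a))).

Definition expansions (w : seq symbol) : seq symbol := flatten (map expansion w).

Lemma expansions_cons a w : expansions (a :: w) = expansion a ++ expansions w.
Proof. by []. Qed.

(** The end of the sentence: closing separator of the block, the [Te] ending the literal, and
    variable 0. *)
Definition tail : seq symbol :=
  encode_bits (letter_code (None : option letter)) ++ [:: Se; Svar].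

(** If [w] is the part of the encoding of a sentence up to its last term, which
    names [w], then [diagonal w] is the whole encoding. *)
Definition diagonal (w : seq symbol) : seq symbol :=
  w ++ expansions w ++ tail.

Definition halting (q : state M) : bool := (q == q_accept M) || (q == q_reject M).

(** A move needs one rule for each symbol of the cell entered, plus one that supplies a blank when
    [Lend] is met. Halting states get no rule, so that their words are final. *)
Definition transition (q : state M) (a : tape_symbol M) : seq (rule letter) :=
  if halting q then [::] else
  let: (q', b, d) := delta q a in
  let S c := Some (Ltape c) in
  match d with
  | Stay => [:: ([:: Lstate q; Ltape a], [::],
                 [:: Some (Lstate q'); S b; None])]
  | Right => ([:: Lstate q; Ltape a; Lend], [::],
              [:: Some (Lstate q'); S None; Some Lend; None; S b])
      :: [seq ([:: Lstate q; Ltape a; Ltape c], [::],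
               [:: Some (Lstate q'); S c; None; S b]) | c : tape_symbol M]
  | Left => ([:: Lstate q; Ltape a], [:: Lend],
             [:: Some (Lstate q'); S None; S b; None; Some Lend])
      :: [seq ([:: Lstate q; Ltape a], [:: Ltape c],
               [:: Some (Lstate q'); S c; S b; None]) | c : tape_symbol M]
  end.

(** Substituting [y] twice duplicates the input: one copy is to be expanded, the other kept. *)
Definition copy_rule : rule letter :=
  ([:: Lcopy], [::], [:: Some Lexpand; None; Some Lend; None]).

(** The word acts as a queue: a symbol is taken from the front and its expansion appended at the
    end. *)
Definition expand_rule (a : symbol) : rule letter :=
  ([:: Lexpand; Linput a], [::],
   [:: Some Lexpand, None & map Some (map Linput (expansion a))]).

Definition finish_rule : rule letter :=
  ([:: Lexpand; Lend], [::],
   [:: Some (Lstate (q_start M)), None & map Some (rcons (map Linput tail) Lend)]).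

Definition machine_rules : seq (rule letter) :=
  [:: copy_rule, finish_rule & [seq expand_rule a | a : symbol]
     ++ flatten [seq transition qa.1 qa.2 | qa : state M * tape_symbol M]].

Lemma machine_rulesP r :
  reflect [\/ r = copy_rule, r = finish_rule, exists a, r = expand_rule a
            | exists q a, r \in transition q a] (r \in machine_rules).
Proof.
rewrite 2!in_cons mem_cat; apply: (iffP or4P).
  case=> [/eqP ->|/eqP ->|/mapP [a _ ->]|/flatten_mapP [[q a] _ rP]].
  - by apply: Or41.
  - by apply: Or42.
  - by apply: Or43; exists a.
  - by apply: Or44; exists q, a.
case=> [->|->|[a ->]|[q [a rP]]].
- by apply: Or41.
- by apply: Or42.
- by apply: Or43; apply: map_f; rewrite mem_enum.
- by apply: Or44; apply/flatten_mapP; exists (q, a); rewrite ?mem_enum.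
Qed.

(** The tape is cut at the head and wrapped around [Lend], so that both
    neighbours of the head are at the ends of the word. *)
Definition config_word (c : config M) : seq letter :=
  let: Config q l a r := c in
  [:: Lstate q, Ltape a & map Ltape r ++ Lend :: rev (map Ltape l)].

Lemma transition_prefix q a r :
  r \in transition q a -> exists p, r.1.1 = [:: Lstate q, Ltape a & p].
Proof.
rewrite /transition; case: ifP => // _; case: (delta q a) => [[q' b] []];
  rewrite ?inE; first 1 last.
- by move/eqP=> ->; exists [::].
- by case/predU1P=> [->|/mapP [c _ ->]]; [exists [:: Lend] | exists [:: Ltape c]].
- by case/predU1P=> [->|/mapP [c _ ->]]; exists [::].
Qed.

Lemma Ltape_inj : injective Ltape.
Proof. by move=> a b []. Qed.

Lemma config_tape_last l r y z :
    map Ltape r ++ Lend :: rev (map Ltape l) = y ++ [:: z] ->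
  match l with
  | [::] => y = map Ltape r /\ z = Lend
  | c :: l' => y = map Ltape r ++ Lend :: rev (map Ltape l') /\ z = Ltape c
  end.
Proof.
rewrite cats1; case: l => [|c l] /=; first by rewrite cats1 => /rcons_inj [].
by rewrite rev_cons -rcons_cons -rcons_cat => /rcons_inj [].
Qed.

(** This yields determinism: whichever transition rule matches, the result is the word of the next
    configuration. *)
Lemma transition_config q l a r rl y :
    rl \in transition q a ->
    config_word (Config q l a r) = rl.1.1 ++ y ++ rl.1.2 ->
  fill y rl.2 = config_word (step (Config q l a r)).
Proof.
rewrite /step /transition -/(halting q); case: ifP => // _.
case: (delta q a) => [[q' b] []].
- case/predU1P=> [->|/mapP [c _ ->]] [] /config_tape_last;
    case: l => [|c' l] [] -> //.
  by move/Ltape_inj => ->; rewrite /fill /= cats0.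
- by rewrite inE => /eqP -> [] /=; rewrite cats0 => <-; rewrite /fill /= cats0.
- case/predU1P=> [->|/mapP [c _ ->]] []; case: r => [|c' r] //=;
    rewrite cats0 => -[]; rewrite /fill /=.
    by move=> <-; rewrite rev_cons cats1.
  by move=> -> <-; rewrite rev_cons -rcons_cons -rcons_cat cats1.
Qed.

Lemma config_rewrites q l a r :
  ~~ halting q ->
  rewrites machine_rules (config_word (Config q l a r))
    (config_word (step (Config q l a r))).
Proof.
move=> q_run.
(* A matching rule suffices, its result being forced by [transition_config]. *)
suff [rl rl_in [y eq_w]] : exists2 rl, rl \in transition q a &
    exists y, config_word (Config q l a r) = rl.1.1 ++ y ++ rl.1.2.
  exists rl y => //; last by rewrite (transition_config rl_in eq_w).
  by apply/machine_rulesP/Or44; exists q, a.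
have enumT (c : tape_symbol M) : c \in enum {: tape_symbol M} by rewrite mem_enum.
rewrite /transition (negbTE q_run); case: (delta q a) => [[q' b] []].
- case: l => [|c l].
    eexists; first exact: mem_head.
    by exists (map Ltape r).
  eexists; first by rewrite in_cons; apply/predU1r/(map_f _ (enumT c)).
  exists (map Ltape r ++ Lend :: rev (map Ltape l)).
  by rewrite /= rev_cons -cats1 -catA.
- eexists; first exact: mem_head.
  by eexists; rewrite /= cats0.
- case: r => [|c r].
    eexists; first exact: mem_head.
    by eexists; rewrite /= cats0.
  eexists; first by rewrite in_cons; apply/predU1r/(map_f _ (enumT c)).
  by eexists; rewrite /= cats0.
Qed.

Lemma rewrites_config c x :
  rewrites machine_rules (config_word c) x <->
  ~~ halting (c_state c) /\ x = config_word (step c).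
Proof.
case: c => q l a r; split=> [|[q_run ->]]; last exact: config_rewrites.
case=> rl y /machine_rulesP [->|->|[b ->]|[q1 [a1 rl_in]]] // eq_w.
have [p1 eq_p] := transition_prefix rl_in.
have [eq_q eq_a] : q1 = q /\ a1 = a by move: eq_w; rewrite eq_p; case.
rewrite {}eq_q {}eq_a in rl_in => ->; split; last exact: transition_config.
by apply: contraTN rl_in => q_halt; rewrite /transition q_halt.
Qed.

Lemma bad_config c :
  (Lstate (q_accept M) \in config_word c) = (c_state c == q_accept M).
Proof.
have not_tape s : (Lstate (q_accept M) \in map Ltape s) = false.
  by apply/mapP=> -[].
by case: c => q l a r; rewrite !inE mem_cat inE mem_rev !not_tape !orbF eq_sym.
Qed.

Lemma leads_run c i :
  leads machine_rules (Lstate (q_accept M)) (config_word c)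
    (config_word (iter i (@step _ M) c)).
Proof.
elim: i => [|i IHi] /=; first exact: leads_refl.
apply: leads_trans IHi _; set c' := iter _ _ _.
(* A halting configuration is a fixed point of [step], which costs no rewriting; a running one is
   not accepting, so its word lacks the bad letter. *)
have [c_halt|c_run] := boolP (halting (c_state c')).
  rewrite (_ : step c' = c'); first exact: leads_refl.
  by case: c' c_halt => q l a r /=; rewrite -/(halting q) => ->.
apply: leads_step.
  rewrite bad_config; apply: contra c_run => /eqP c'_acc.
  by rewrite /halting c'_acc eqxx.
by move=> y; split=> [/rewrites_config [] //|->]; apply/rewrites_config.
Qed.

Lemma leads_copy w :
  leads machine_rules (Lstate (q_accept M)) (Lcopy :: map Linput w)
    (Lexpand :: map Linput w ++ Lend :: map Linput w).
Proof.
apply: leads_step => [|y]; first by rewrite inE; apply/mapP=> -[].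
split=> [[r z /machine_rulesP [->|->|[b ->]|[q [a /transition_prefix [p ->]]]]] // [] |->].
  by rewrite /= cats0 => -> ->; rewrite /fill /= cats0.
exists copy_rule (map Linput w); first by apply/machine_rulesP/Or41.
  by rewrite /= cats0.
by rewrite /fill /= cats0.
Qed.

(** Induction on the copy being consumed; [v] is general because it collects the expansions. *)
Lemma leads_expand w v :
  leads machine_rules (Lstate (q_accept M))
    (Lexpand :: map Linput w ++ Lend :: map Linput v)
    (Lexpand :: Lend :: map Linput (v ++ expansions w)).
Proof.
elim: w v => [|a w IHw] v; first by rewrite /= cats0; apply: leads_refl.
rewrite expansions_cons catA; apply: leads_trans (IHw _); apply: leads_step => [|y].
  by rewrite inE mem_cat inE; apply/norP; split=> //;
    apply/norP; split; [apply/mapP=> -[] | apply/norP; split=> //; apply/mapP=> -[]].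
split=> [[r z /machine_rulesP [->|->|[b ->]|[q [c /transition_prefix [p ->]]]]] //|->].
  case=> <-; rewrite cats0 => <- ->.
  by rewrite 2!fill_cons fill_Some map_cat -catA.
exists (expand_rule a) (map Linput w ++ Lend :: map Linput v).
- by apply/machine_rulesP/Or43; exists a.
- by rewrite cats0.
- by rewrite 2!fill_cons fill_Some map_cat -catA.
Qed.

Lemma leads_finish v :
  leads machine_rules (Lstate (q_accept M)) (Lexpand :: Lend :: map Linput v)
    (Lstate (q_start M) :: rcons (map Linput (v ++ tail)) Lend).
Proof.
apply: leads_step => [|y]; first by rewrite !inE; apply/mapP=> -[].
have fillE : fill (map Linput v) finish_rule.2
    = Lstate (q_start M) :: rcons (map Linput (v ++ tail)) Lend.
  by rewrite 2!fill_cons fill_Some map_cat rcons_cat.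
split=> [[r z /machine_rulesP [->|->|[b ->]|[q [c /transition_prefix [p ->]]]]] //|->].
  by case; rewrite cats0 => <- ->.
exists finish_rule (map Linput v); first by apply/machine_rulesP/Or42.
  by rewrite cats0.
by rewrite fillE.
Qed.

Lemma leads_init w :
  leads machine_rules (Lstate (q_accept M)) (Lcopy :: map Linput w)
    (config_word (init M (diagonal w))).
Proof.
apply: leads_trans (leads_copy w) _; apply: leads_trans (leads_expand w w) _.
apply: leads_trans (leads_finish _) _; rewrite -catA -/(diagonal w).
(* On an empty input [init] would scan a blank, a letter that the rewritten word does not
   contain. *)
have: size (diagonal w) != 0 by rewrite !size_cat !addn_eq0 [size [:: Se; _] == 0]/= !andbF.
case: (diagonal w) => //= a v _; rewrite -map_comp -cats1.
exact: leads_refl.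
Qed.

Lemma accepts_reach w :
  accepts M (diagonal w) ->
  exists2 x, reach machine_rules (Lcopy :: map Linput w) x
           & Lstate (q_accept M) \in x.
Proof.
case=> i acc.
have [wx _] := leads_trans (leads_init w) (leads_run (init M (diagonal w)) i).
by eexists; [exact: wx | rewrite bad_config acc].
Qed.

Lemma rejects_safe w :
  rejects M (diagonal w) ->
  safe machine_rules (Lstate (q_accept M)) (Lcopy :: map Linput w).
Proof.
case=> i rej.
have [_] := leads_trans (leads_init w) (leads_run (init M (diagonal w)) i).
apply; apply: safe_halt => [|x /rewrites_config []].
  by rewrite bad_config rej eq_sym accept_neq_reject.
by rewrite rej /halting eqxx orbT.
Qed.

Lemma encode_word_code (w : seq symbol) :
  encode_bits (word_code (map (Some \o Linput) w)) = expansions w.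
Proof.
elim: w => // a w IHw; rewrite map_cons expansions_cons -IHw -encode_bits_cat.
by congr encode_bits.
Qed.

Definition sentence_prefix (n m k : nat) : seq symbol :=
  [:: Sex, Svar, Sand & encode (side_form machine_rules (Lstate (q_accept M)) n m k)]
  ++ Ssub :: encode_bits (letter_code (None : option letter))
  ++ encode_bits (letter_code (Some Lcopy)).

(** For [w := sentence_prefix n m k] the right-hand side is [diagonal w]: the sentence then speaks
    about its own text. *)
Lemma encode_safe_form n m k w :
  encode (safe_form machine_rules (Lstate (q_accept M)) n m k (Lcopy :: map Linput w))
  = sentence_prefix n m k ++ expansions w ++ tail.
Proof.
rewrite /safe_form; set side := side_form _ _ _ _ _.
have -> x : encode (Fex 0 (Fand side (Fsub (code_term (block x) Te) (Var 0))))
    = [:: Sex, Svar, Sand & encode side]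
      ++ Ssub :: encode_term (code_term (block x) Te) ++ [:: Svar] by [].
rewrite /code_term encode_bits_term word_code_block -(cat1s Lcopy) map_cat.
rewrite word_code_cat [map Some [:: Lcopy]]/= word_code1 -map_comp.
rewrite !encode_bits_cat encode_word_code /sentence_prefix /tail -/side.
move: (encode_bits _) (encode_bits _) (expansions w) (encode side) => e1 e2 e s.
by rewrite /= -!catA /= -!catA.
Qed.

End Simulation.

(** * The diagonal argument *)

Theorem undecidable_fragment n m k : undecidable (fragment n.+1 m k.+1).
Proof.
case=> M M_decides.
pose w := sentence_prefix M n m k.
pose phi := safe_form (machine_rules M) (Lstate (q_accept M)) n m k
              (Lcopy M :: map (@Linput M) w).
have phiE : encode phi = diagonal M w by apply: encode_safe_form.
have phi_true : true_in frakB phi <->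
    exists2 f, fragment n.+1 m k.+1 f & diagonal M w = encode f.
  split=> [phiP|[f [_ _ fP]]]; last by rewrite -phiE => /encode_inj ->.
  by exists phi => //; split=> //; [apply: Sigma_safe_form | apply: sentence_safe_form].
have [M_acc M_rej] := M_decides (diagonal M w).
(* If [phi] were true, [M] would accept its text and the accepting state would be reached, making
   [phi] false. *)
have phi_false : ~ true_in frakB phi.
  move=> phiP; have [x wx x_acc] := accepts_reach (M_acc (phi_true.1 phiP)).
  exact: reach_bad_unsafe wx x_acc phiP.
(* As [phi] is false, [M] rejects its text; the run is then safe and [phi] true. *)
by apply/phi_false/safe_true/rejects_safe/M_rej => /phi_true.
Qed.

Theorem theorem17 :
  undecidable (fragment 1 2 1) /\ undecidable (fragment 1 0 2).
Proof. by split; apply: undecidable_fragment. Qed.
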